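(* Let $c_0$ be a proper $4$-colouring of the plane, let $\mu$ be a left-invariant finitely additive probability measure on $S_4\times E(2)$, and let $p_d$ be the associated monochromaticity probabilities (see context). Then for real $d$: (1) if $\frac12\le d\le\sqrt{(3-\sqrt3)\left(1-\frac1{\sqrt2}\right)}$, then $p_d\ge\frac1{125}$; (2) if $\sqrt{(3-\sqrt3)\left(1-\frac1{\sqrt2}\right)}<d\le\sqrt{\frac{19}{15}-\frac2{\sqrt5}}$, then $p_d\ge\frac{28}{3875}$; (3) if $\sqrt{\frac{19}{15}-\frac2{\sqrt5}}<d\le\frac12\sqrt{5-2\sqrt3}$, then $p_d\ge\frac1{250}$; (4) if $\frac12\sqrt{5+2\sqrt3}\le d<\sqrt{\frac{19}{15}+\frac2{\sqrt5}}$, then $p_d\ge\frac1{250}$; (5) if $\sqrt{\frac{19}{15}+\frac2{\sqrt5}}\le d<\sqrt{(3-\sqrt3)\left(1+\frac1{\sqrt2}\right)}$, then $p_d\ge\frac{28}{3875}$; (6) if $\sqrt{(3-\sqrt3)\left(1+\frac1{\sqrt2}\right)}\le d$, then $p_d\ge\frac1{125}$.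
   Context: Identify the plane with $\mathbb C$. A proper $4$-colouring of the plane is a map $c_0:\mathbb C\to\{1,2,3,4\}$ such that no two points at distance $1$ have the same colour. Let $S_4$ be the group of permutations of the colours and $E(2)$ the group of Euclidean isometries of the plane. The group $S_4\times E(2)$ is amenable, so there is a finitely additive probability measure $\mu$ defined on all subsets of $S_4\times E(2)$ which is left-invariant, i.e. $\mu(gE)=\mu(E)$ for all $g\in S_4\times E(2)$ and $E\subseteq S_4\times E(2)$. For $(\sigma,T)\in S_4\times E(2)$ consider the (random) colouring $c=\sigma\circ c_0\circ T^{-1}$. For $d\ge 0$, $p_d$ denotes the probability that two points $A,B$ at distance $d$ get the same colour: $p_d=\mu(\{(\sigma,T): c(A)=c(B)\})$; by left-invariance this does not depend on the choice of $A,B$ with $|AB|=d$. The existence of $c_0$ is a standing assumption, and $c_0,\mu$ are arbitrary but fixed. *)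

(* Defs.v *)
From HB Require Import structures.
From mathcomp Require Import all_boot all_order all_algebra all_fingroup.
From mathcomp Require Import boolp classical_sets reals.
From mathcomp Require Import complex.

Set Implicit Arguments.
Unset Strict Implicit.
Unset Printing Implicit Defensive.

Import Order.TTheory GRing.Theory Num.Theory.

Local Open Scope classical_set_scope.
Local Open Scope complex_scope.
Local Open Scope ring_scope.

(* The plane is R[i], whose norm `|z| is the Euclidean modulus, seen as a
   (real) element of R[i]; hence the coercions %:C in distance conditions. *)

Definition proper_colouring (R : realType) (k : nat) (c : R[i] -> 'I_k) : Prop :=
  forall A B : R[i], `|A - B| = 1 -> c A <> c B.

Record isometry (R : realType) : Type := Isometry {
  iso_fun :> R[i] -> R[i];
  iso_inv : R[i] -> R[i];
  iso_funK : cancel iso_fun iso_inv;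
  iso_invK : cancel iso_inv iso_fun;
  iso_dist : forall z w : R[i], `|iso_fun z - iso_fun w| = `|z - w|
}.

HB.instance Definition _ (R : realType) := gen_eqMixin (isometry R).
HB.instance Definition _ (R : realType) := gen_choiceMixin (isometry R).

Section IsometryOperations.
Variable R : realType.
Implicit Types S T : isometry R.

Lemma isometry_ext S T : iso_fun S =1 iso_fun T -> S = T.
Proof.
case: S T => [f f' fK f'K fd] [g g' gK g'K gd] /= /funext efg; subst g.
have efg' : f' = g' by apply/funext => z; rewrite -{1}[z]g'K fK.
subst g'; congr Isometry; exact: Prop_irrelevance.
Qed.

Definition iso_id : isometry R :=
  @Isometry R id id (fun=> erefl) (fun=> erefl) (fun _ _ => erefl).

Fact iso_comp_dist S T z w : `|S (T z) - S (T w)| = `|z - w|.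
Proof. by rewrite !iso_dist. Qed.

Definition iso_comp S T : isometry R :=
  @Isometry R (S \o T) (iso_inv T \o iso_inv S)
    (can_comp (@iso_funK R S) (@iso_funK R T))
    (can_comp (@iso_invK R T) (@iso_invK R S))
    (@iso_comp_dist S T).

Fact iso_inverse_dist T z w : `|iso_inv T z - iso_inv T w| = `|z - w|.
Proof. by rewrite -(iso_dist T) !iso_invK. Qed.

Definition iso_inverse T : isometry R :=
  @Isometry R (iso_inv T) (iso_fun T) (@iso_invK R T) (@iso_funK R T)
    (@iso_inverse_dist T).

End IsometryOperations.

(* S_4 x E(2), with composition of maps as product in both factors. In the
   group 'S_4 of the library (s * t) x = t (s x), hence the swap below; with the
   library's product, left-invariance would be a different condition. *)
Definition S4E2 (R : realType) : Type := ('S_4 * isometry R)%type.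

Section S4E2Group.
Variable R : realType.
Implicit Types g h k : S4E2 R.

Definition S4E2_one : S4E2 R := (1%g, iso_id R).
Definition S4E2_mul g h : S4E2 R := ((h.1 * g.1)%g, iso_comp g.2 h.2).
Definition S4E2_inv g : S4E2 R := (g.1^-1%g, iso_inverse g.2).

Fact S4E2_mulA : associative S4E2_mul.
Proof.
by move=> g h k; congr pair; [rewrite /= mulgA | apply: isometry_ext].
Qed.

Fact S4E2_mul1 : left_id S4E2_one S4E2_mul.
Proof.
by case=> s T; congr pair; [rewrite /= mulg1 | apply: isometry_ext].
Qed.

Fact S4E2_mulr1 : right_id S4E2_one S4E2_mul.
Proof.
by case=> s T; congr pair; [rewrite /= mul1g | apply: isometry_ext].
Qed.

Fact S4E2_mulV : left_inverse S4E2_one S4E2_inv S4E2_mul.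
Proof.
case=> s T; congr pair; first by rewrite /= mulgV.
by apply: isometry_ext => z /=; rewrite iso_funK.
Qed.

Fact S4E2_mulrV : right_inverse S4E2_one S4E2_inv S4E2_mul.
Proof.
case=> s T; congr pair; first by rewrite /= mulVg.
by apply: isometry_ext => z /=; rewrite iso_invK.
Qed.

HB.instance Definition _ :=
  Choice.copy (S4E2 R) ('S_4 * isometry R)%type.
HB.instance Definition _ := isGroup.Build (S4E2 R)
  S4E2_mulA S4E2_mul1 S4E2_mulr1 S4E2_mulV S4E2_mulrV.

End S4E2Group.

(* A finitely additive probability measure defined on all subsets of G. *)
Record fin_add_probability (R : realType) (G : Type) (mu : set G -> R) : Prop :=
  FinAddProbability {
    fap_ge0 : forall E : set G, 0 <= mu E;
    fap_setT : mu setT = 1;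
    fap_setU : forall E F : set G,
      E `&` F = set0 -> mu (E `|` F) = mu E + mu F
  }.

Definition left_invariant (R : realType) (G : groupType) (mu : set G -> R) : Prop :=
  forall (g : G) (E : set G), mu [set (g * h)%g | h in E] = mu E.

(* The colouring sigma \o c0 \o T^-1. *)
Definition moved_colouring (R : realType) (c0 : R[i] -> 'I_4) (g : S4E2 R) :
  R[i] -> 'I_4 := fun z => g.1 (c0 (iso_inv g.2 z)).

Definition same_colour (R : realType) (c0 : R[i] -> 'I_4) (A B : R[i]) :
  set (S4E2 R) := [set g | moved_colouring c0 g A = moved_colouring c0 g B].

(* p_d is computed on the pair 0, d; mono_probE below shows that any two points
   at distance d give the same value. *)
Definition mono_prob (R : realType) (c0 : R[i] -> 'I_4) (mu : set (S4E2 R) -> R)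
  (d : R) : R := mu (same_colour c0 0 d%:C).

Fact rot_dist (R : realType) (A u : R[i]) (hu : `|u| = 1) (z w : R[i]) :
  `|(A + u * z) - (A + u * w)| = `|z - w|.
Proof. by rewrite opprD addrACA subrr add0r -mulrBr normrM hu mul1r. Qed.

Lemma mono_probE (R : realType) (c0 : R[i] -> 'I_4) (mu : set (S4E2 R) -> R)
    (mu_inv : left_invariant mu) (A B : R[i]) (d : R) (hd : `|A - B| = d%:C) :
  mu (same_colour c0 A B) = mono_prob c0 mu d.
Proof.
have [u hu eB] : exists2 u : R[i], `|u| = 1 & B = A + u * d%:C.
  have [d0|d0] := eqVneq d 0.
    exists 1; first by rewrite normr1.
    move: hd; rewrite d0 => /eqP; rewrite normr_eq0 subr_eq0 => /eqP ->.
    by rewrite mulr0 addr0.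
  have dC0 : d%:C != 0 :> R[i] by rewrite fmorph_eq0.
  exists ((B - A) / d%:C); last by rewrite divfK // addrC subrK.
  by rewrite normrM normfV distrC -hd normr_id divff // hd.
have u0 : u != 0 by rewrite -normr_eq0 hu oner_eq0.
pose f z := A + u * z; pose f' z := u^-1 * (z - A).
have fK : cancel f f' by move=> z; rewrite /f /f' addrAC subrr add0r mulKf.
have f'K : cancel f' f by move=> z; rewrite /f /f' mulVKf // addrC subrK.
pose g : S4E2 R := (1%g, Isometry fK f'K (@rot_dist R A u hu)).
rewrite /mono_prob -(mu_inv g (same_colour c0 0 _)); congr mu; apply/seteqP; split=> h /=.
  move=> hAB; exists (g^-1 * h)%g; last by rewrite mulgA mulgV mul1g.
  move: hAB; rewrite /same_colour /moved_colouring /= !permM /f eB.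
  by rewrite invg1 !perm1 mulr0 addr0.
case=> k hk <-; move: hk.
rewrite /same_colour /moved_colouring /= !permM !perm1 /f' eB.
by rewrite subrr mulr0 addrAC subrr add0r mulKf.
Qed.

(* Main.v *)
Require Import Defs.
From mathcomp Require Import all_boot all_order all_algebra all_fingroup.
From mathcomp Require Import boolp classical_sets reals.
From mathcomp Require Import complex.
From mathcomp Require Import ring lra.

(** Write h = sqrt (d^2 - 1/4) and let A, A' be the points h -+ sqrt 3 / 2 on
    the real axis: they are the apexes of the two unit triangles on the unit edge
    B0 E0, whose ends h +- i/2 are at distance d from P = 0.  Rotate this edge
    about P by 60 degrees to B1 E1.  Then A A' = sqrt 3, while the segments A P, B0 E1
    have the same length y = |h - sqrt 3 / 2|, the segments A' P, E0 B1 have length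
    y' = h + sqrt 3 / 2, and not only P B1, P E1, B0 B1, E0 E1 but also A B1 and A' E1
    have length d.  Counting monochromatic pairs in any proper 4-colouring gives
      3 p_y + 3 p_y' + 18 p_d >= 3 + p_(sqrt 3).
    Two points at unit distance on a circle of radius r >= 1/2 cannot both have the
    colour of its centre, so p_r <= 1/2; and p_2 + 2 p_(sqrt 3) >= 1, hence
    p_(sqrt 3) >= 1/4.  As soon as y >= 1/2 this yields p_d >= 1/72, which is
    better than all six required bounds; y >= 1/2 means that
    d^2 <= (5 - 2 sqrt 3) / 4 or d^2 >= (5 + 2 sqrt 3) / 4. *)

Set Implicit Arguments.
Unset Strict Implicit.
Unset Printing Implicit Defensive.

Import Order.TTheory GRing.Theory Num.Theory.
Local Open Scope ring_scope.

(** * Inequalities for finitely additive probability measures *)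

Section FinitelyAdditive.
Local Open Scope classical_set_scope.
Variables (R : realType) (G : Type) (mu : set G -> R).
Hypothesis mu_prob : fin_add_probability mu.
Implicit Types D E : set G.

Lemma fap_set0 : mu set0 = 0.
Proof.
have := fap_setU mu_prob (setI0 (@set0 G)).
by rewrite setU0 => /eqP; rewrite -subr_eq0 opprD addNKr oppr_eq0 => /eqP.
Qed.

Lemma fap_split D E : mu D = mu (D `&` E) + mu (D `&` ~` E).
Proof.
rewrite -(fap_setU mu_prob); last by rewrite setIACA setICr setI0.
by rewrite -setIUr setUCr setIT.
Qed.

(** Averages a pointwise inequality between weighted indicators without building an integral: the
    space is cut along each set of [s] in turn. *)
Lemma fap_sum_ge (s : seq (R * set G)) (b : R) :
  (forall g, b <= \sum_(t <- s) t.1 * (`[< t.2 g >])%:R) ->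
  b <= \sum_(t <- s) t.1 * mu t.2.
Proof.
move=> sb; suff gen D : (forall g, D g ->
    b <= \sum_(t <- s) t.1 * (`[< t.2 g >])%:R) ->
    b * mu D <= \sum_(t <- s) t.1 * mu (D `&` t.2).
  have := gen setT (fun g _ => sb g); rewrite (fap_setT mu_prob) mulr1.
  by under eq_bigr do rewrite setTI.
elim: s b D {sb} => [|[a E] s IHs] b D sD.
  (* No sets are left: [D] is null, or one of its points forces [b <= 0]. *)
  rewrite big_nil; have [->|/set0P[g Dg]] := eqVneq D set0.
    by rewrite fap_set0 mulr0.
  by have := sD g Dg; rewrite big_nil => b0; rewrite mulr_le0_ge0 ?(fap_ge0 mu_prob).
rewrite big_cons /= (fap_split D E) mulrDr.
have in_E : (b - a) * mu (D `&` E) <= \sum_(t <- s) t.1 * mu (D `&` E `&` t.2).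
  apply: IHs => g [Dg Eg]; have := sD g Dg.
  by rewrite big_cons /= asboolT // mulr1 -lerBlDl.
have out_E : b * mu (D `&` ~` E) <= \sum_(t <- s) t.1 * mu (D `&` ~` E `&` t.2).
  apply: IHs => g [Dg nEg]; have := sD g Dg.
  by rewrite big_cons /= asboolF // mulr0 add0r.
have -> : \sum_(t <- s) t.1 * mu (D `&` t.2) =
    \sum_(t <- s) t.1 * mu (D `&` E `&` t.2) +
    \sum_(t <- s) t.1 * mu (D `&` ~` E `&` t.2).
  rewrite -big_split; apply: eq_bigr => t _ /=.
  by rewrite (fap_split (D `&` t.2) E) mulrDr -!(setIAC D t.2).
lra.
Qed.

End FinitelyAdditive.

(** * Exhaustive checks over four colours *)

Lemma all_iota_ord n (P : pred nat) (i : 'I_n) : all P (iota 0 n) -> P i.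
Proof. by move/allP; apply; rewrite mem_iota add0n leq0n ltn_ord. Qed.

(* Two unit triangles a b e and b c f, with a, b, c collinear. *)
Lemma line_count (a b c e f : 'I_4) :
  a != b -> b != c -> e != a -> e != b -> f != b -> f != c -> e != f ->
  (1 <= (a == c) + ((a == f) + (c == e)))%N.
Proof.
have /all_iota_ord-/(_ a) : all (fun a => all (fun b => all (fun c => all (fun e =>
    all (fun f =>
    [&& a != b, b != c, e != a, e != b, f != b, f != c & e != f] ==>
    (1 <= (a == c) + ((a == f) + (c == e)))%N)
  (iota 0 4)) (iota 0 4)) (iota 0 4)) (iota 0 4)) (iota 0 4) by vm_compute.
move=> /all_iota_ord-/(_ b)/all_iota_ord-/(_ c)/all_iota_ord-/(_ e).
by move=> /all_iota_ord-/(_ f)/implyP H *; apply: H; apply/and5P; split=> //; apply/and3P.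
Qed.

(* The hypotheses are the unit distances of the configuration.  If no pair at
   distance d is monochromatic, let x, y, z be the colours other than that of p,
   with e0 = x and b0 = y.  Then (e1, b1) is (y, x), (y, z) or (z, x), so one of
   b0 = e1, e0 = b1 holds, and both do when a = a' = z.  On the other hand
   a, a' lie in {p, z}.  The inequality is twice the former count plus the
   latter; the last summand pays for the pairs at distance d. *)
Lemma hexagon_count (p b0 e0 b1 e1 a a' : 'I_4) :
  b0 != e0 -> b1 != e1 -> a != b0 -> a != e0 -> a' != b0 -> a' != e0 ->
  (3 + (a == a') <= 2 * ((b0 == e1) + (e0 == b1)) + ((a == p) + (a' == p)) +
     (3 * ((p == b0) + (p == e0)) +
      2 * ((p == b1) + (p == e1) + (b0 == b1) + (e0 == e1) +
           (a' == e1) + (a == b1))))%N.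
Proof.
have /all_iota_ord-/(_ p) : all (fun p => all (fun b0 => all (fun e0 => all (fun b1 =>
    all (fun e1 => all (fun a => all (fun a' =>
    [&& b0 != e0, b1 != e1, a != b0, a != e0, a' != b0 & a' != e0] ==>
  (3 + (a == a') <= 2 * ((b0 == e1) + (e0 == b1)) + ((a == p) + (a' == p)) +
     (3 * ((p == b0) + (p == e0)) +
      2 * ((p == b1) + (p == e1) + (b0 == b1) + (e0 == e1) +
           (a' == e1) + (a == b1))))%N)
  (iota 0 4)) (iota 0 4)) (iota 0 4)) (iota 0 4)) (iota 0 4)) (iota 0 4)) (iota 0 4)
  by vm_compute.
move=> /all_iota_ord-/(_ b0)/all_iota_ord-/(_ e0)/all_iota_ord-/(_ b1).
move=> /all_iota_ord-/(_ e1)/all_iota_ord-/(_ a)/all_iota_ord-/(_ a')/implyP H *.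
by apply: H; apply/and5P; split=> //; apply/andP.
Qed.

(** * From colour counts to probability bounds *)

Section MonoProb.
Variables (R : realType) (c0 : R[i] -> 'I_4) (mu : set (S4E2 R) -> R).
Hypothesis c0_proper : proper_colouring c0.
Hypothesis mu_prob : fin_add_probability mu.
Hypothesis mu_inv : left_invariant mu.

Local Notation p_ := (mono_prob c0 mu).
Local Notation col g z := (moved_colouring c0 g z).

Lemma sqr_sqrt_height (d : R) : 1 / 2 <= d ->
  Num.sqrt (d ^+ 2 - 1 / 4) ^+ 2 = d ^+ 2 - 1 / 4.
Proof. by move=> d2; rewrite sqr_sqrtr //; nra. Qed.

Lemma norm_complex (x y r : R) : 0 <= r -> x ^+ 2 + y ^+ 2 = r ^+ 2 ->
  `|(x +i* y)%C| = (r%:C)%C.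
Proof. by move=> r0 xyr; rewrite normc_def /= xyr sqrtr_sqr ger0_norm. Qed.

Lemma col_neq (x y x' y' : R) g : (x - x') ^+ 2 + (y - y') ^+ 2 = 1 ->
  col g (x +i* y)%C != col g (x' +i* y')%C.
Proof.
move=> dist1; apply/eqP => /perm_inj; apply: c0_proper.
rewrite (iso_dist (iso_inverse g.2)).
have -> : (x +i* y)%C - (x' +i* y')%C = ((x - x') +i* (y - y'))%C by [].
by rewrite (@norm_complex _ _ 1) ?expr1n.
Qed.

Lemma mu_same_colour (x y x' y' r : R) : 0 <= r ->
  (x - x') ^+ 2 + (y - y') ^+ 2 = r ^+ 2 ->
  mu (same_colour c0 (x +i* y)%C (x' +i* y')%C) = p_ r.
Proof. by move=> r0 distr; apply: mono_probE => //; apply: norm_complex. Qed.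

Lemma mono_sum_ge (s : seq (R * (R[i] * R[i]))) (b : R) :
  (forall g, b <= \sum_(t <- s) t.1 * (col g t.2.1 == col g t.2.2)%:R) ->
  b <= \sum_(t <- s) t.1 * mu (same_colour c0 t.2.1 t.2.2).
Proof.
move=> sb.
have := @fap_sum_ge _ _ _ mu_prob
  [seq (t.1, same_colour c0 t.2.1 t.2.2) | t <- s] b.
rewrite big_map; apply => g; rewrite big_map.
suff -> : \sum_(t <- s) t.1 * (`[< same_colour c0 t.2.1 t.2.2 g >])%:R =
    \sum_(t <- s) t.1 * (col g t.2.1 == col g t.2.2)%:R by exact: sb.
by apply: eq_bigr => t _; congr (_ * _%:R); congr nat_of_bool; apply/asboolP/eqP.
Qed.

Lemma mono_prob_le_half r : 1 / 2 <= r -> p_ r <= 1 / 2.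
Proof.
move=> r2; pose h : R := Num.sqrt (r ^+ 2 - 1 / 4).
have h2 : h ^+ 2 = r ^+ 2 - 1 / 4 := sqr_sqrt_height r2.
pose O : R[i] := (0 +i* 0)%C.
pose X : R[i] := (h +i* (1 / 2))%C; pose Y : R[i] := (h +i* (- (1 / 2)))%C.
(* Weights [-1] turn the upper bound into a lower one. *)
pose T : seq (R * (R[i] * R[i])) := [:: (-1, (X, O)); (-1, (Y, O))].
have sum_ge g : -1 <= \sum_(t <- T) t.1 * (col g t.2.1 == col g t.2.2)%:R.
  rewrite !big_cons !big_nil /= !mulN1r addr0 -opprD lerN2 -natrD lern1.
  have XY : col g X != col g Y by apply: col_neq; lra.
  have [XO|_] := eqVneq (col g X) (col g O); last by case: (_ == _).
  by rewrite eq_sym -XO (negbTE XY).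
have := mono_sum_ge sum_ge; rewrite !big_cons !big_nil /=.
by rewrite !(@mu_same_colour _ _ _ _ r); lra.
Qed.

Local Notation s3 := (Num.sqrt 3 : R).

Lemma sqrt3_sqr : s3 ^+ 2 = 3.
Proof. by rewrite sqr_sqrtr. Qed.

Lemma sqrt3_bounds : 19 / 11 <= s3 <= 7 / 4.
Proof. by have := sqrt3_sqr; have := sqrtr_ge0 (3 : R); move=> *; apply/andP; nra. Qed.

Lemma mono_prob_sqrt3_ge : 1 / 4 <= p_ s3.
Proof.
have s32 := sqrt3_sqr; have s30 := sqrtr_ge0 (3 : R).
pose A : R[i] := (0 +i* 0)%C; pose B : R[i] := (1 +i* 0)%C.
pose C : R[i] := (2 +i* 0)%C; pose E : R[i] := (1 / 2 +i* (s3 / 2))%C.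
pose F : R[i] := (3 / 2 +i* (s3 / 2))%C.
(* The unit triangles are [A B E] and [B C F]; [A F] and [C E] have length [s3], [A C] length 2. *)
pose T : seq (R * (R[i] * R[i])) := [:: (1, (A, C)); (1, (A, F)); (1, (C, E))].
have sum_ge g : 1 <= \sum_(t <- T) t.1 * (col g t.2.1 == col g t.2.2)%:R.
  rewrite !big_cons !big_nil /= !mul1r addr0 -!natrD ler1n.
  by apply: (@line_count _ (col g B)); apply: col_neq; lra.
have := mono_sum_ge sum_ge; rewrite !big_cons !big_nil /=.
rewrite (@mu_same_colour _ _ _ _ 2); try lra.
rewrite !(@mu_same_colour _ _ _ _ s3); try lra.
by have := @mono_prob_le_half 2; lra.
Qed.

(** The absolute value serves both ranges of [d]: [h] lies below [s3 / 2] in the small one, above it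
    in the large one. *)
Lemma mono_prob_hexagon (d : R) (h := Num.sqrt (d ^+ 2 - 1 / 4) : R) : 1 / 2 <= d ->
  3 + p_ s3 <= 3 * p_ `|h - s3 / 2| + 3 * p_ (h + s3 / 2) + 18 * p_ d.
Proof.
move=> d_ge.
have s32 := sqrt3_sqr; have s30 := sqrtr_ge0 (3 : R).
have h0 : 0 <= h := sqrtr_ge0 _.
have h2 : h ^+ 2 = d ^+ 2 - 1 / 4 by exact: sqr_sqrt_height.
(* This monomial occurs in the squared lengths at [B1] and [E1]; its value makes them linear for
   [lra]. *)
have sh2 : s3 ^+ 2 * h ^+ 2 = 3 * (d ^+ 2 - 1 / 4) by rewrite s32 h2.
have y2 : `|h - s3 / 2| ^+ 2 = h ^+ 2 - h * s3 + 3 / 4.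
  by rewrite real_normK ?num_real //; lra.
have y0 : 0 <= `|h - s3 / 2| by [].
pose P : R[i] := (0 +i* 0)%C.
pose B0 : R[i] := (h +i* (1 / 2))%C.
pose E0 : R[i] := (h +i* (- (1 / 2)))%C.
(* [B1] and [E1] are [B0] and [E0] times [1/2 + i s3/2]. *)
pose B1 : R[i] := ((h / 2 - s3 / 4) +i* (s3 * h / 2 + 1 / 4))%C.
pose E1 : R[i] := ((h / 2 + s3 / 4) +i* (s3 * h / 2 - 1 / 4))%C.
pose A : R[i] := ((h - s3 / 2) +i* 0)%C.
pose A' : R[i] := ((h + s3 / 2) +i* 0)%C.
pose T : seq (R * (R[i] * R[i])) := [:: (-1, (A, A')); (2, (B0, E1));
  (2, (E0, B1)); (1, (A, P)); (1, (A', P)); (3, (P, B0)); (3, (P, E0)); (2, (P, B1)); (2, (P, E1));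
  (2, (B0, B1)); (2, (E0, E1)); (2, (A', E1)); (2, (A, B1))].
have sum_ge g : 3 <= \sum_(t <- T) t.1 * (col g t.2.1 == col g t.2.2)%:R.
  have := @hexagon_count (col g P) (col g B0) (col g E0) (col g B1) (col g E1)
    (col g A) (col g A').
  do 6![move=> /(_ ltac:(apply: col_neq; lra))].
  by rewrite -(ler_nat R) !(natrD, natrM) !big_cons big_nil /=; lra.
have := mono_sum_ge sum_ge; rewrite !big_cons !big_nil /=.
rewrite (@mu_same_colour _ _ _ _ s3) //; last lra.
rewrite (@mu_same_colour _ _ _ _ `|h - s3 / 2|) //; last lra.
rewrite (@mu_same_colour _ _ _ _ (h + s3 / 2)); [|lra|lra].
rewrite (@mu_same_colour _ _ _ _ `|h - s3 / 2|) //; last lra.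
rewrite (@mu_same_colour _ _ _ _ (h + s3 / 2)); [|lra|lra].
rewrite !(@mu_same_colour _ _ _ _ d); try lra.
Qed.

(** The bounds combine to [18 p_d >= 3 + 1/4 - 3/2 - 3/2 = 1/4]. *)
Lemma mono_prob_ge d : 1 / 2 <= d ->
  1 / 2 <= `|Num.sqrt (d ^+ 2 - 1 / 4) - s3 / 2| -> 1 / 72 <= p_ d.
Proof.
move=> d2 y2; have := mono_prob_hexagon d2; have := mono_prob_sqrt3_ge.
have := mono_prob_le_half y2.
have y'2 : 1 / 2 <= Num.sqrt (d ^+ 2 - 1 / 4) + s3 / 2.
  have /andP[s3_ge _] := sqrt3_bounds.
  by have := sqrtr_ge0 (d ^+ 2 - 1 / 4); lra.
by have := mono_prob_le_half y'2; lra.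
Qed.

Lemma mono_prob_ge_small d : 1 / 2 <= d -> d ^+ 2 <= (5 - 2 * s3) / 4 ->
  1 / 72 <= p_ d.
Proof.
move=> d2 dle; apply: mono_prob_ge => //.
have /andP[s3_ge _] := sqrt3_bounds; have s32 := sqrt3_sqr.
have h0 := sqrtr_ge0 (d ^+ 2 - 1 / 4).
have h2 := sqr_sqrt_height d2.
move: h0 h2; set h := Num.sqrt (d ^+ 2 - _) => h0 h2.
(* The square of [(s3 - 1) / 2] is [(5 - 2 * s3) / 4 - 1 / 4]. *)
have hle : h <= (s3 - 1) / 2 by nra.
by rewrite distrC ger0_norm; lra.
Qed.

Lemma mono_prob_ge_large d : 0 <= d -> (5 + 2 * s3) / 4 <= d ^+ 2 ->
  1 / 72 <= p_ d.
Proof.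
move=> d0 dge; have /andP[s3_ge _] := sqrt3_bounds; have s32 := sqrt3_sqr.
have h0 := sqrtr_ge0 (d ^+ 2 - 1 / 4).
have d2 : 1 / 2 <= d by nra.
have h2 := sqr_sqrt_height d2; apply: mono_prob_ge => //.
move: h0 h2; set h := Num.sqrt (d ^+ 2 - _) => h0 h2.
have hge : (s3 + 1) / 2 <= h by nra.
by rewrite ger0_norm; lra.
Qed.

End MonoProb.

Theorem mainTheorem7 (R : realType) (c0 : R[i] -> 'I_4) (mu : set (S4E2 R) -> R)
    (c0_proper : proper_colouring c0)
    (mu_prob : fin_add_probability mu) (mu_inv : left_invariant mu) (d : R) :
  (1 / 2 <= d <= Num.sqrt ((3 - Num.sqrt 3) * (1 - 1 / Num.sqrt 2)) ->
     1 / 125 <= mono_prob c0 mu d)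
  /\
  (Num.sqrt ((3 - Num.sqrt 3) * (1 - 1 / Num.sqrt 2)) < d
     <= Num.sqrt (19 / 15 - 2 / Num.sqrt 5) ->
     28 / 3875 <= mono_prob c0 mu d)
  /\
  (Num.sqrt (19 / 15 - 2 / Num.sqrt 5) < d
     <= 1 / 2 * Num.sqrt (5 - 2 * Num.sqrt 3) ->
     1 / 250 <= mono_prob c0 mu d)
  /\
  (1 / 2 * Num.sqrt (5 + 2 * Num.sqrt 3) <= d
     < Num.sqrt (19 / 15 + 2 / Num.sqrt 5) ->
     1 / 250 <= mono_prob c0 mu d)
  /\
  (Num.sqrt (19 / 15 + 2 / Num.sqrt 5) <= d
     < Num.sqrt ((3 - Num.sqrt 3) * (1 + 1 / Num.sqrt 2)) ->
     28 / 3875 <= mono_prob c0 mu d)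
  /\
  (Num.sqrt ((3 - Num.sqrt 3) * (1 + 1 / Num.sqrt 2)) <= d ->
     1 / 125 <= mono_prob c0 mu d).
Proof.
have /andP[s3_ge s3_le] := sqrt3_bounds R.
have /andP[t_ge t_le] : 12 / 17 <= 1 / Num.sqrt (2 : R) <= 5 / 7.
  have := sqrtr_ge0 (2 : R); have : Num.sqrt (2 : R) ^+ 2 = 2 by rewrite sqr_sqrtr.
  move: (Num.sqrt 2) => q q2 q0; have q_gt0 : 0 < q by nra.
  by rewrite ler_pdivlMr // ler_pdivrMr //; apply/andP; split; nra.
have /andP[v_ge v_le] : 25 / 28 <= 2 / Num.sqrt (5 : R) <= 9 / 10.
  have := sqrtr_ge0 (5 : R); have : Num.sqrt (5 : R) ^+ 2 = 5 by rewrite sqr_sqrtr.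
  move: (Num.sqrt 5) => q q2 q0; have q_gt0 : 0 < q by nra.
  by rewrite ler_pdivlMr // ler_pdivrMr //; apply/andP; split; nra.
have small e : 1 / 2 <= d -> d <= Num.sqrt e -> 0 <= e -> e <= (5 - 2 * Num.sqrt 3) / 4 ->
    1 / 72 <= mono_prob c0 mu d.
  move=> d2 de e0 e_le; apply: mono_prob_ge_small => //.
  apply: (le_trans _ e_le); rewrite -(sqr_sqrtr e0) lerXn2r ?nnegrE ?sqrtr_ge0 //.
  by lra.
have large e : Num.sqrt e <= d -> (5 + 2 * Num.sqrt 3) / 4 <= e ->
    1 / 72 <= mono_prob c0 mu d.
  move=> ed e_ge; have d0 : 0 <= d := le_trans (sqrtr_ge0 e) ed.
  have e0 : 0 <= e by lra.
  apply: mono_prob_ge_large => //; apply: (le_trans e_ge).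
  by rewrite -(sqr_sqrtr e0) lerXn2r ?nnegrE ?sqrtr_ge0.
(* In cases (2) and (3), [1 / 2 <= d] comes from the lower threshold. *)
have half e : 1 / 4 <= e -> Num.sqrt e < d -> 1 / 2 <= d.
  move=> e_ge /ltW; apply: le_trans.
  rewrite -[1 / 2]ger0_norm -?sqrtr_sqr; [|lra].
  by apply: ler_wsqrtr; lra.
have e1_ge : 1 / 4 <= (3 - Num.sqrt 3) * (1 - 1 / Num.sqrt (2 : R)).
  by apply: le_trans (_ : 5 / 4 * (2 / 7) <= _); [lra | apply: ler_pM; lra].
(* Tight: about 0.3743 against 0.375, which dictates the precision of the rational bounds on the
   roots. *)
have e1_le : (3 - Num.sqrt 3) * (1 - 1 / Num.sqrt (2 : R)) <= (5 - 2 * Num.sqrt 3) / 4.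
  by apply: le_trans (_ : _ <= 14 / 11 * (5 / 17)) _; [apply: ler_pM; lra | lra].
have e4_ge : (5 + 2 * Num.sqrt 3) / 4 <= (3 - Num.sqrt 3) * (1 + 1 / Num.sqrt (2 : R)).
  by apply: le_trans (_ : 5 / 4 * (29 / 17) <= _); [lra | apply: ler_pM; lra].
have half_sqrt (e : R) : 0 <= e -> 1 / 2 * Num.sqrt e = Num.sqrt (e / 4).
  move=> e0; have -> : 1 / 2 = Num.sqrt (1 / 4 : R).
    by rewrite (_ : 1 / 4 = (1 / 2) ^+ 2) ?sqrtr_sqr ?ger0_norm //; lra.
  by rewrite -sqrtrM; [congr Num.sqrt; lra | lra].
rewrite !half_sqrt; try lra.
split; [|split; [|split; [|split; [|split]]]].
- move=> /andP[d2 d_le]; suff : 1 / 72 <= mono_prob c0 mu d by lra.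
  by apply: (small _ _ d_le) => //; lra.
- move=> /andP[/half-/(_ e1_ge) d2 d_le]; suff : 1 / 72 <= mono_prob c0 mu d by lra.
  by apply: (small _ _ d_le) => //; lra.
- move=> /andP[/half d2 d_le]; suff : 1 / 72 <= mono_prob c0 mu d by lra.
  by apply: (small _ _ d_le); [apply: d2 | | ]; lra.
- move=> /andP[d_ge _]; suff : 1 / 72 <= mono_prob c0 mu d by lra.
  by apply: (large _ d_ge); lra.
- move=> /andP[d_ge _]; suff : 1 / 72 <= mono_prob c0 mu d by lra.
  by apply: (large _ d_ge); lra.
- move=> d_ge; suff : 1 / 72 <= mono_prob c0 mu d by lra.
  by apply: (large _ d_ge); lra.
Qed.
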